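(* Let $\mathcal L$ be a centerless Lie torus of type $(\Delta,\Lambda)$ with $\Delta$ reduced, equipped with a Chevalley involution $\tau$. Then $(\mathcal L,\tau)$ admits a Chevalley system.
   Context: All vector spaces are over $\mathbb C$. $\Lambda$ is a free abelian group of finite rank and $\Delta$ an irreducible finite root system (containing $0$; $\Delta^\times=\Delta\setminus\{0\}$) with root lattice $Q$. A Lie torus of type $(\Delta,\Lambda)$ is a $(Q\times\Lambda)$-graded Lie algebra $\mathcal L=\bigoplus_{(\alpha,\lambda)}\mathcal L^\lambda_\alpha$ with $\mathcal L^\lambda_\alpha=0$ for $\alpha\notin\Delta$ such that: for $\alpha\in\Delta^\times$, $\lambda\in\Lambda$, $\dim\mathcal L^\lambda_\alpha\le1$, and $\dim\mathcal L^0_\alpha=1$ if $\frac12\alpha\notin\Delta$; if $\dim\mathcal L^\lambda_\alpha=1$ ($\alpha\in\Delta^\times$) there are $0\ne e^{\pm\lambda}_{\pm\alpha}\in\mathcal L^{\pm\lambda}_{\pm\alpha}$ with $[[e^\lambda_\alpha,e^{-\lambda}_{-\alpha}],x]=\langle\beta,\alpha^\vee\rangle x$ for all $\beta\in\Delta$, $\mu\in\Lambda$, $x\in\mathcal L^\mu_\beta$; $\mathcal L^\lambda_0=\sum_{\alpha\in\Delta^\times,\mu\in\Lambda}[\mathcal L^\mu_\alpha,\mathcal L^{\lambda-\mu}_{-\alpha}]$; and $\Lambda=\mathrm{span}_{\mathbb Z}\{\lambda\mid\mathcal L^\lambda_\alpha\neq0\text{ for some }\alpha\in\Delta\}$. It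 is centerless if its center is $0$. $\mathcal L^\lambda=\sum_\alpha\mathcal L^\lambda_\alpha$ and $\mathrm{supp}(\mathcal L)=\{(\dot\alpha,\lambda)\in\Delta\times\Lambda\mid\mathcal L^\lambda_{\dot\alpha}\neq\{0\}\}$. A Chevalley involution for $\mathcal L$ is a finite order automorphism $\tau$ of $\mathcal L$ with $\tau(\mathcal L^\lambda)=\mathcal L^{-\lambda}$ for $\lambda\in\Lambda$ and $\tau(h)=-h$ for $h\in\mathcal L^0_0$ (it follows that $\tau(\mathcal L^\lambda_{\dot\alpha})=\mathcal L^{-\lambda}_{-\dot\alpha}$). A Chevalley system for $(\mathcal L,\tau)$ is a set $\{x^\lambda_{\dot\alpha}\in\mathcal L^\lambda_{\dot\alpha}\mid(\dot\alpha,\lambda)\in\mathrm{supp}(\mathcal L),\ \dot\alpha\neq0\}$ such that for each such $(\dot\alpha,\lambda)$: (i) $(x^\lambda_{\dot\alpha},h^\lambda_{\dot\alpha},x^{-\lambda}_{-\dot\alpha})$ with $h^\lambda_{\dot\alpha}:=[x^\lambda_{\dot\alpha},x^{-\lambda}_{-\dot\alpha}]$ is an $\mathfrak{sl}_2$-triple (i.e. $[h^\lambda_{\dot\alpha},x^{\pm\lambda}_{\pm\dot\alpha}]=\pm2x^{\pm\lambda}_{\pm\dot\alpha}$); (ii) $\tau(x^\lambda_{\dot\alpha})=-x^{-\lambda}_{-\dot\alpha}$. *)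

(* Defs.v *)
From HB Require Import structures.
From mathcomp Require Import all_boot all_order all_algebra finmap.
From mathcomp Require Import all_classical reals complex.

Set Implicit Arguments.
Unset Strict Implicit.
Unset Printing Implicit Defensive.

Import GRing.Theory.

Local Open Scope classical_set_scope.
Local Open Scope ring_scope.

Definition zspan (M : zmodType) (A : set M) : set M :=
  [set x | exists n (c : 'I_n -> int) (v : 'I_n -> M),
     (forall i, A (v i)) /\ x = \sum_(i < n) v i *~ c i].

Definition lspan (K : fieldType) (L : lmodType K) (A : set L) : set L :=
  [set x | exists n (c : 'I_n -> K) (v : 'I_n -> L),
     (forall i, A (v i)) /\ x = \sum_(i < n) c i *: v i].

Definition subspace (K : fieldType) (L : lmodType K) (A : set L) : Prop :=
  A 0 /\ forall (c : K) (x y : L), A x -> A y -> A (c *: x + y).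

(* \dim is only available inside a vectType; the ambient space here may be
   infinite-dimensional. *)
Definition has_dim (K : fieldType) (L : lmodType K) (A : set L) (n : nat) :
    Prop :=
  subspace A /\
  exists2 e : 'I_n -> L, (forall i, A (e i)) &
    forall x, A x -> exists! c : {ffun 'I_n -> K}, x = \sum_(i < n) c i *: e i.

Definition free_of_finite_rank (M : zmodType) : Prop :=
  exists n (e : 'I_n -> M), forall x : M,
    exists! c : {ffun 'I_n -> int}, x = \sum_(i < n) e i *~ c i.

HB.mixin Record Lmodule_isLieAlgebra (K : fieldType) L
    of GRing.Lmodule K L := {
  lie : L -> L -> L;
  lie_linearl : forall y, linear (fun x => lie x y);
  lie_linearr : forall x, linear (lie x);
  liexx : forall x, lie x x = 0;
  lie_jacobi : forall x y z,
    lie x (lie y z) + lie y (lie z x) + lie z (lie x y) = 0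
}.

#[short(type="lieAlgType")]
HB.structure Definition LieAlgebra (K : fieldType) :=
  {L of GRing.Lmodule K L & Lmodule_isLieAlgebra K L}.

Section LieAlgebraNotions.
Variables (K : fieldType) (L : lieAlgType K).

Definition lie_center : set L := [set z | forall x, lie z x = 0].

Definition centerless : Prop := lie_center = [set 0].

Record lie_automorphism (f : L -> L) : Prop := LieAutomorphism {
  lie_aut_linear : linear f;
  lie_aut_bijective : bijective f;
  lie_aut_lie : forall x y, f (lie x y) = lie (f x) (f y)
}.

(* h != 0 excludes the triple (0, 0, 0), so that e, h, f span a copy of sl_2 *)
Record sl2_triple (e h f : L) : Prop := SL2Triple {
  sl2_neq0 : h != 0;
  sl2_ef : lie e f = h;
  sl2_he : lie h e = 2 *: e;
  sl2_hf : lie h f = - (2 *: f)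
}.

Record lie_grading (G : zmodType) (S : G -> set L) : Prop := LieGrading {
  grading_subspace : forall g, subspace (S g);
  grading_span : forall x, exists (s : seq G) (y : G -> L),
    (forall g, S g (y g)) /\ x = \sum_(g <- s) y g;
  grading_free : forall (s : seq G) (y : G -> L), uniq s ->
    (forall g, g \in s -> S g (y g)) -> \sum_(g <- s) y g = 0 ->
    forall g, g \in s -> y g = 0;
  grading_lie : forall g h x y, S g x -> S h y -> S (g + h) (lie x y)
}.

End LieAlgebraNotions.

(* The roots include 0.  coroot a is only meaningful for a nonzero root a, in
   which case it is determined by the other fields, and coroot a b is the
   integer <b, a^vee>. *)
Record root_system (K : numFieldType) (V : vectType K) := RootSystem {
  roots :> {fset V};
  coroot : V -> {scalar V};
  roots0 : 0 \in roots;
  roots_span : forall v : V, lspan [set` roots] v;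
  coroot_self : forall a, a \in roots -> a != 0 -> coroot a a = 2;
  coroot_refl : forall a b, a \in roots -> a != 0 -> b \in roots ->
    b - coroot a b *: a \in roots;
  coroot_int : forall a b, a \in roots -> a != 0 -> b \in roots ->
    exists n : int, coroot a b = n%:~R
}.

Section RootSystemNotions.
Variables (K : numFieldType) (V : vectType K) (D : root_system V).

Definition reduced : Prop :=
  forall a, a \in roots D -> a != 0 -> 2 *: a \notin roots D.

Definition irreducible : Prop :=
  (exists2 a, a \in roots D & a != 0) /\
  forall P : pred V,
    (forall a b, a \in roots D -> a != 0 -> P a ->
                 b \in roots D -> b != 0 -> ~~ P b ->
                 coroot D b a = 0 /\ coroot D a b = 0) ->
    (forall a, a \in roots D -> a != 0 -> P a) \/
    (forall a, a \in roots D -> a != 0 -> ~~ P a).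

Definition in_root_lattice : {pred V} :=
  [pred v | `[< zspan [set` roots D] v >]].

Lemma in_root_lattice_zmod_closed : zmod_closed in_root_lattice.
Proof.
split=> [|x y].
  apply/asboolP; exists 0%N.
  exists (fun=> 0); exists (fun=> 0).
  by split=> [[]|] //; rewrite big_ord0.
move=> /asboolP[m [c [v [Dv ->]]]] /asboolP[n [d [w [Dw ->]]]].
apply/asboolP; exists (m + n)%N.
exists (fun i : 'I_(m + n) => match fintype.split i with
  inl j => c j | inr j => - d j end).
exists (fun i : 'I_(m + n) => match fintype.split i with
  inl j => v j | inr j => w j end).
split=> [i|]; first by case: (fintype.split i).
rewrite big_split_ord /= -sumrN; congr (_ + _); apply: eq_bigr => i _.
  by rewrite (unsplitK (inl i)).
by rewrite (unsplitK (inr i)) mulrNz.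
Qed.

HB.instance Definition _ :=
  GRing.isZmodClosed.Build V in_root_lattice in_root_lattice_zmod_closed.

Record root_lattice := RootLattice {
  root_lattice_val :> V;
  _ : in_root_lattice root_lattice_val
}.

HB.instance Definition _ := [isSub for root_lattice_val].
HB.instance Definition _ := [Choice of root_lattice by <:].
HB.instance Definition _ := [SubChoice_isSubZmodule of root_lattice by <:].

End RootSystemNotions.

Section LieTori.
Variables (K : numFieldType) (V : vectType K) (D : root_system V).
Variables (Lam : zmodType) (L : lieAlgType K).
(* S (a, l) is the homogeneous component of degree (a, l). *)
Variable S : root_lattice D * Lam -> set L.

Record lie_torus : Prop := LieTorus {
  torus_grading : lie_grading S;
  torus_supp : forall (a : root_lattice D) (l : Lam),
    \val a \notin roots D -> S (a, l) = [set 0];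
  torus_dim : forall (a : root_lattice D) (l : Lam),
    \val a \in roots D -> a != 0 ->
    exists2 n, (n <= 1)%N & has_dim (S (a, l)) n;
  torus_dim0 : forall a : root_lattice D,
    \val a \in roots D -> a != 0 -> 2^-1 *: \val a \notin roots D ->
    has_dim (S (a, 0)) 1;
  torus_pair : forall (a : root_lattice D) (l : Lam),
    \val a \in roots D -> a != 0 -> has_dim (S (a, l)) 1 ->
    exists e f : L,
      [/\ S (a, l) e, e != 0, S (- a, - l) f, f != 0 &
          forall (b : root_lattice D) (m : Lam) (x : L),
            \val b \in roots D -> S (b, m) x ->
            lie (lie e f) x = coroot D (\val a) (\val b) *: x];
  torus_zero : forall l : Lam,
    S (0, l) = lspan [set z | exists (a : root_lattice D) (m : Lam) (x y : L),
      [/\ \val a \in roots D, a != 0, S (a, m) x, S (- a, l - m) y &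
          z = lie x y]];
  torus_span : zspan [set l : Lam | exists2 a : root_lattice D,
      \val a \in roots D & S (a, l) <> [set 0]] = setT
}.

Definition torus_support : set (root_lattice D * Lam) :=
  [set p | \val p.1 \in roots D /\ S p <> [set 0]].

Definition external_component (l : Lam) : set L :=
  lspan [set x | exists a : root_lattice D, S (a, l) x].

Record chevalley_involution (tau : L -> L) : Prop := ChevalleyInvolution {
  chevalley_aut : lie_automorphism tau;
  chevalley_finite_order :
    exists2 n, (0 < n)%N & forall x, iter n tau x = x;
  chevalley_component : forall l,
    tau @` external_component l = external_component (- l);
  chevalley_cartan : forall h, S (0, 0) h -> tau h = - h
}.

(* The values of x outside the support, or in degrees (0, l), are junk. *)
Definition chevalley_system (tau : L -> L)
    (x : root_lattice D -> Lam -> L) : Prop :=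
  forall (a : root_lattice D) (l : Lam), torus_support (a, l) -> a != 0 ->
    [/\ S (a, l) (x a l),
        sl2_triple (x a l) (lie (x a l) (x (- a) (- l))) (x (- a) (- l)) &
        tau (x a l) = - x (- a) (- l)].

End LieTori.

(* Main.v *)
(* For a nonzero root a, the involution negates the Cartan part S (0, 0), so it
   turns an eigenvector of S (0, 0) of weight a into one of weight -a; as the
   coroots separate -a from the other roots, it maps S (a, l) to S (-a, -l).
   Given a pair e, f as in the definition of a Lie torus, tau e = - c f with
   c != 0, and since tau negates [e, f] one gets tau f = - c^-1 e.  Dividing e
   by a square root of c gives x such that x, - tau x is an sl_2-pair and
   tau (tau x) = x.  The system is then obtained by choosing such an x in one
   degree out of each pair {p, -p}. *)
Require Import Defs.
From HB Require Import structures.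
From mathcomp Require Import all_boot all_order all_algebra finmap.
From mathcomp Require Import all_classical reals complex.

Set Implicit Arguments.
Unset Strict Implicit.
Unset Printing Implicit Defensive.

Import GRing.Theory Num.Theory.

Local Open Scope classical_set_scope.
Local Open Scope ring_scope.

(* fingraph.roots shadows the projection. *)
Local Notation roots := Defs.roots.

(** * Bilinearity and antisymmetry of the bracket *)

Section LieBracket.
Variables (K : fieldType) (L : lieAlgType K).
Implicit Types (x y z : L) (k : K).

Lemma lieDr x y z : lie x (y + z) = lie x y + lie x z.
Proof. by have := lie_linearr x 1 y z; rewrite !scale1r. Qed.

Lemma lieDl x y z : lie (x + y) z = lie x z + lie y z.
Proof. by have := lie_linearl z 1 x y; rewrite !scale1r. Qed.

Lemma lie0r x : lie x 0 = 0.
Proof. by apply: (addrI (lie x 0)); rewrite -lieDr !addr0. Qed.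

Lemma lie0l x : lie 0 x = 0.
Proof. by apply: (addrI (lie 0 x)); rewrite -lieDl !addr0. Qed.

Lemma lieZr k x y : lie x (k *: y) = k *: lie x y.
Proof. by have := lie_linearr x k y 0; rewrite lie0r !addr0. Qed.

Lemma lieZl k x y : lie (k *: x) y = k *: lie x y.
Proof. by have := lie_linearl y k x 0; rewrite lie0l !addr0. Qed.

Lemma lieNr x y : lie x (- y) = - lie x y.
Proof. by rewrite -scaleN1r lieZr scaleN1r. Qed.

Lemma lieNl x y : lie (- x) y = - lie x y.
Proof. by rewrite -scaleN1r lieZl scaleN1r. Qed.

Lemma lieC x y : lie x y = - lie y x.
Proof.
apply/eqP; rewrite -addr_eq0; apply/eqP.
have := liexx (x + y).
by rewrite lieDl !lieDr !liexx add0r addr0.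
Qed.

End LieBracket.

(** * Separation of roots by coroots, and doubling in the root lattice *)

Section Roots.
Variables (K : numFieldType) (V : vectType K) (D : root_system V).

Lemma root_opp (a : V) : a \in roots D -> - a \in roots D.
Proof.
have [->|a0] := eqVneq a 0; first by rewrite oppr0.
move=> Da; have := coroot_refl Da a0 Da.
by rewrite coroot_self // scaler_nat mulr2n opprD addrA subrr add0r.
Qed.

(* With v = a + c, the reflections in a and a + v send every root a + k v to
   the root a + (k + 2) v, so finiteness forces v = 0. *)
Lemma root_eq_opp (a c : V) : a \in roots D -> a != 0 -> c \in roots D ->
  (forall b, b \in roots D -> b != 0 -> coroot D b c = - coroot D b a) ->
  c = - a.
Proof.
move=> Da a0 Dc cN; apply/eqP; rewrite -addr_eq0; apply/negPn/negP=> v0.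
pose v := c + a; have cE : c = v - a by rewrite addrK.
have vb b : b \in roots D -> b != 0 -> coroot D b v = 0.
  by move=> Db b0; rewrite raddfD /= cN // addNr.
have av0 : a + v != 0.
  apply/negP => /eqP av; have := vb a Da a0.
  have -> : v = - a by apply/eqP; rewrite -addr_eq0 addrC av.
  rewrite raddfN /= coroot_self // => /eqP.
  by rewrite oppr_eq0 pnatr_eq0.
have Dav : a + v \in roots D.
  have := coroot_refl Da a0 Dc; rewrite cE raddfB /= vb // coroot_self //.
  by rewrite sub0r scaleNr opprK scaler_nat mulr2n addrA subrK addrC.
have step w : a + w \in roots D -> (forall b, b \in roots D -> b != 0 ->
    coroot D b w = 0) -> a + (w + v *+ 2) \in roots D.
  move=> Daw w0.
  have Dw : w - a \in roots D.
    have := coroot_refl Da a0 Daw; rewrite raddfD /= w0 // coroot_self // addr0.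
    by rewrite scaler_nat mulr2n opprD !addrA [a + w]addrC addrK.
  have aav : coroot D (a + v) a = 2.
    by rewrite -(coroot_self Dav av0) raddfD /= (vb (a + v)) // addr0.
  have := coroot_refl Dav av0 Dw; rewrite raddfB /= w0 // aav sub0r scaleNr.
  by rewrite opprK scaler_nat mulrnDl [a *+ 2]mulr2n !addrA subrK
    [w + a]addrC -addrA.
(* The walk starts at [a + v] and advances by [2v], so exactly the odd multiples of [v] occur. *)
pose w k := v *+ (k.*2).+1.
have Dw k : a + w k \in roots D.
  elim: k => [|k IH]; first by rewrite /w.
  have -> : w k.+1 = w k + v *+ 2 by rewrite /w -mulrnDr addn2 doubleS.
  apply: step => // b Db b0.
  by rewrite raddfMn /= vb // mul0rn.
have w_inj : injective (fun k => a + w k).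
  move=> i j /addrI /eqP; rewrite /w -!scaler_nat -subr_eq0 -scalerBl.
  rewrite scaler_eq0 (negPf v0) orbF subr_eq0 eqr_nat eqSS => /eqP.
  exact: double_inj.
(* One more term than there are roots, for the pigeonhole principle. *)
pose s := [seq a + w k | k <- iota 0 (size (enum_fset (roots D))).+1].
have : (size s <= size (enum_fset (roots D)))%N.
  apply: uniq_leq_size; first by rewrite map_inj_uniq // iota_uniq.
  by move=> _ /mapP[k _ ->]; exact: Dw.
by rewrite size_map size_iota ltnn.
Qed.

Lemma root_in_lattice (b : V) : b \in roots D ->
  exists b' : root_lattice D, \val b' = b.
Proof.
move=> Db; have H : b \in in_root_lattice D.
  apply/asboolP; exists 1%N; exists (fun=> 1); exists (fun=> b).
  by split=> //; rewrite big_ord1 mulr1z.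
by exists (RootLattice H).
Qed.

(** Makes [torus_dim0] available at every nonzero root. *)
Lemma reduced_half (b : V) : reduced D -> b \in roots D -> b != 0 ->
  2^-1 *: b \notin roots D.
Proof.
move=> Dred Db b0; apply/negP => /Dred.
rewrite scaler_eq0 invr_eq0 pnatr_eq0 (negPf b0) => /(_ isT).
by rewrite scalerA divff ?pnatr_eq0 // scale1r Db.
Qed.

Lemma root_lattice_val_eq0 (a : root_lattice D) : (\val a == 0) = (a == 0).
Proof. by apply/eqP/eqP => [va|->//]; apply: val_inj. Qed.

(** Characteristic 0 gives this; it keeps the degrees [p] and [- p] apart in the final choice. *)
Lemma root_lattice_neq_opp (a : root_lattice D) : a != 0 -> a != - a.
Proof.
apply: contra => /eqP/(congr1 val)/eqP; rewrite -subr_eq0 raddfN /= opprK.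
rewrite -mulr2n -scaler_nat scaler_eq0 pnatr_eq0.
by rewrite root_lattice_val_eq0.
Qed.

End Roots.

(** * Subspaces and dimension at most one *)

Section Subspaces.
Variables (K : fieldType) (L : lmodType K) (A : set L).
Hypothesis Asub : subspace A.

Lemma subspaceZ k x : A x -> A (k *: x).
Proof. by case: Asub => A0 AD Ax; rewrite -[k *: x]addr0; apply: AD. Qed.

Lemma subspaceD x y : A x -> A y -> A (x + y).
Proof. by case: Asub => A0 AD Ax Ay; rewrite -[x]scale1r; apply: AD. Qed.

Lemma subspaceN x : A x -> A (- x).
Proof. by rewrite -scaleN1r; apply: subspaceZ. Qed.

Lemma has_dim_le1 n e x : (n <= 1)%N -> has_dim A n -> A e -> e != 0 -> A x ->
  exists k, x = k *: e.
Proof.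
case: n => [|[|//]] _ [_ [u _ uP]] Ae e0 Ax.
  by have [c [eE _]] := uP _ Ae; rewrite eE big_ord0 eqxx in e0.
have [c [eE _]] := uP _ Ae; have [d [xE _]] := uP _ Ax.
rewrite big_ord1 in eE; rewrite big_ord1 in xE.
have c0 : c ord0 != 0 by apply: contra e0 => /eqP c0; rewrite eE c0 scale0r.
by exists (d ord0 / c ord0); rewrite {1}xE eE scalerA divfK.
Qed.

(** Sharpens the bound of [torus_dim] to the equality that [torus_pair] requires. *)
Lemma has_dim_neq0 n : (n <= 1)%N -> has_dim A n -> A <> [set 0] -> has_dim A 1.
Proof.
case: n => [|[|//]] // _ [_ [u _ uP]] AN0; case: AN0.
apply/seteqP; split=> x /=; last by move=> ->; case: Asub.
by move=> /uP[c [-> _]]; rewrite big_ord0.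
Qed.

End Subspaces.

(** * The involution on the homogeneous components *)

Section LieTorus.
Variables (K : numClosedFieldType) (V : vectType K) (D : root_system V).
Variables (Lam : zmodType) (L : lieAlgType K).
Variables (S : root_lattice D * Lam -> set L) (tau : L -> L).
Hypotheses (Dred : reduced D) (torusS : lie_torus S).
Hypothesis tauP : chevalley_involution S tau.
Implicit Types (a b : root_lattice D) (l m : Lam).

Let S_subspace p : subspace (S p) := grading_subspace (torus_grading torusS) p.

Definition coroot_acts b (h : L) := forall a m x,
  \val a \in roots D -> S (a, m) x -> lie h x = coroot D (\val b) (\val a) *: x.

(** A pair in degrees [(b, 0)] and [(- b, 0)] has its bracket in [S (0, 0)], which acts as the
    coroot of [b]. *)
Lemma cartan_exists b : \val b \in roots D -> b != 0 ->
  exists2 h, S (0, 0) h & coroot_acts b h.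
Proof.
move=> Db b0; have vb0 : \val b != 0 by rewrite root_lattice_val_eq0.
have [e [f [Se _ Sf _ ef]]] :=
  torus_pair torusS Db b0 (torus_dim0 torusS Db b0 (reduced_half Dred Db vb0)).
exists (lie e f); last exact: ef.
by have := grading_lie (torus_grading torusS) Se Sf; rewrite /= !subrr.
Qed.

(* Whenever some b other than -a contributes to z, a Cartan element separating
   b from -a kills that contribution and rescales z by a nonzero scalar. *)
Lemma weight_component a l z : \val a \in roots D -> a != 0 ->
  external_component S l z ->
  (forall b h, \val b \in roots D -> b != 0 -> S (0, 0) h -> coroot_acts b h ->
     lie h z = - coroot D (\val b) (\val a) *: z) ->
  S (- a, l) z.
Proof.
move=> Da a0 [n [c [v [vS zE]]]].
(* Absorbing the coefficients allows induction on the number of summands. *)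
have {c v vS zE} : exists v : 'I_n -> L,
    (forall i, exists b, S (b, l) (v i)) /\ z = \sum_(i < n) v i.
  exists (fun i => c i *: v i); split=> // i.
  by have [b Sb] := vS i; exists b; apply: subspaceZ.
elim: n z => [|n IH] z [v [vS zE]] zw.
  by rewrite zE big_ord0; case: (S_subspace (- a, l)).
rewrite big_ord_recr /= in zE.
pose s := \sum_(i < n) v (widen_ord (leqnSn n) i).
have sS : exists w : 'I_n -> L,
    (forall i, exists b, S (b, l) (w i)) /\ s = \sum_(i < n) w i.
  by exists (fun i => v (widen_ord (leqnSn n) i)).
rewrite -/s in zE; have [b] := vS ord_max; move: (v ord_max) zE => u zE Su.
have [Db|Db] := boolP (\val b \in roots D); last first.
  move: Su; rewrite (torus_supp torusS) // => u0; rewrite u0 addr0 in zE.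
  by apply: IH => //; rewrite zE.
(* If [b = - a], then [u] already has the required weights, so [z - u] keeps the weight
   hypothesis. *)
have [bE|bNa] := eqVneq b (- a).
  rewrite bE in Su; rewrite zE; apply: subspaceD => //; apply: IH => //.
  move=> d h Dd d0 Sh hP; have -> : s = z - u by rewrite zE addrK.
  rewrite lieDr lieNr (zw d h) // (hP (- a) l u) //; last by rewrite -bE.
  by rewrite !raddfN /= scalerDr scalerN.
(* Otherwise all coroots would agree on [b] and [- a], and [root_eq_opp] would give [b = - a]. *)
have [d [Dd d0 dba]] : exists d : root_lattice D,
    [/\ \val d \in roots D, d != 0 &
    coroot D (\val d) (\val b) + coroot D (\val d) (\val a) != 0].
  apply: contrapT => Nd; case/eqP: bNa; apply: val_inj; rewrite raddfN /=.
  apply: (@root_eq_opp _ _ D) => //.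
  move=> d Dd d0; apply/eqP; rewrite -addr_eq0; apply/negPn/negP => dN.
  have [d' d'E] := root_in_lattice Dd.
  apply: Nd; exists d'; rewrite d'E; split=> //.
  by rewrite -root_lattice_val_eq0 d'E.
have [h Sh hP] := cartan_exists Dd d0.
set k := coroot D (\val d) (\val b) in dba.
pose z' := lie h z - k *: z.
have z'E : z' = - (k + coroot D (\val d) (\val a)) *: z.
  by rewrite /z' (zw d h) // -scalerBl opprD addrC.
suff Sz' : S (- a, l) z'.
  have -> : z = (- (k + coroot D (\val d) (\val a)))^-1 *: z'.
    by rewrite z'E scalerA mulVf ?scale1r // oppr_eq0.
  exact: subspaceZ.
apply: IH.
  exists (fun i => lie h (v (widen_ord (leqnSn n) i))
                   - k *: v (widen_ord (leqnSn n) i)).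
  split.
    move=> i; have [b' Sb'] := vS (widen_ord (leqnSn n) i); exists b'.
    apply: subspaceD => //.
      have := grading_lie (torus_grading torusS) Sh Sb'.
      by rewrite /= !add0r.
    by apply: subspaceN => //; apply: subspaceZ.
  rewrite sumrB -scaler_sumr -(big_morph (lie h) (lieDr h) (lie0r h)) -/s.
  by rewrite /z' zE lieDr (hP b l u) // scalerDr opprD addrACA subrr addr0.
move=> d' h' Dd' d'0 Sh' h'P.
by rewrite z'E lieZr (zw d' h') // !scalerA mulrC.
Qed.

Let tau_lin : linear tau := lie_aut_linear (chevalley_aut tauP).

Lemma tau0 : tau 0 = 0.
Proof.
by have := tau_lin (-1) 0 0; rewrite scaler0 addr0 scaleN1r addNr.
Qed.

Lemma tauZ k x : tau (k *: x) = k *: tau x.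
Proof. by have := tau_lin k x 0; rewrite tau0 !addr0. Qed.

Lemma tauN x : tau (- x) = - tau x.
Proof. by rewrite -scaleN1r tauZ scaleN1r. Qed.

(** The definition of [tau] controls only the degree in [Lam]; the degree in the root lattice is
    recovered from the weights of [tau x]. *)
Lemma tau_component a l x : \val a \in roots D -> a != 0 -> S (a, l) x ->
  S (- a, - l) (tau x).
Proof.
move=> Da a0 Sx; apply: weight_component => //.
  rewrite -(chevalley_component tauP); exists x => //.
  exists 1%N, (fun=> 1), (fun=> x).
  by split=> [_|]; [exists a | rewrite big_ord1 scale1r].
move=> b h Db b0 Sh hP.
have -> : lie h (tau x) = - tau (lie h x).
  by rewrite (lie_aut_lie (chevalley_aut tauP)) (chevalley_cartan tauP Sh)
    lieNl opprK.
by rewrite (hP a l x) // tauZ scaleNr.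
Qed.

(** The clause [tau (tau x) = x] is recorded because [tau] may have order larger than 2; it lets [x]
    and [- tau x] exchange roles. *)
Lemma chevalley_pair a l : \val a \in roots D -> a != 0 ->
  S (a, l) <> [set 0] ->
  exists x, [/\ S (a, l) x, S (- a, - l) (- tau x),
    sl2_triple x (lie x (- tau x)) (- tau x) & tau (tau x) = x].
Proof.
move=> Da a0 Sal; have [n n1 dimn] := torus_dim torusS l Da a0.
have [e [f [Se e0 Sf f0 efP]]] :=
  torus_pair torusS Da a0 (has_dim_neq0 (S_subspace _) n1 dimn Sal).
have DNa : \val (- a) \in roots D by rewrite raddfN /= root_opp.
have Na0 : - a != 0 by rewrite oppr_eq0.
have va0 : \val a != 0 by rewrite root_lattice_val_eq0.
have [n' n'1 dimn'] := torus_dim torusS (- l) DNa Na0.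
have [c fE] := has_dim_le1 n'1 dimn' Sf f0
  (subspaceN (S_subspace _) (tau_component Da a0 Se)).
have tf : S (a, l) (tau f).
  by have := tau_component DNa Na0 Sf; rewrite !opprK.
have [d eE] := has_dim_le1 n1 dimn Se e0 (subspaceN (S_subspace _) tf).
have {fE}te : tau e = - (c *: f) by rewrite -fE opprK.
have {eE}{}tf : tau f = - (d *: e) by rewrite -eE opprK.
have he : lie (lie e f) e = 2 *: e.
  by rewrite (efP a l e) // coroot_self.
have hf : lie (lie e f) f = - (2 *: f).
  by rewrite (efP (- a) (- l) f) // !raddfN /= coroot_self // scaleNr.
have h0 : lie e f != 0.
  apply: contra e0 => /eqP h0; move: he; rewrite h0 lie0l => /esym/eqP.
  by rewrite scaler_eq0 pnatr_eq0.
have Sh : S (0, 0) (lie e f).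
  by have := grading_lie (torus_grading torusS) Se Sf; rewrite /= !subrr.
(* Compare [tau [e, f] = - [e, f]] with [[tau e, tau f] = cd [f, e]]. *)
have cd : c * d = 1.
  have := chevalley_cartan tauP Sh.
  rewrite (lie_aut_lie (chevalley_aut tauP)) te tf lieNl lieNr opprK.
  rewrite lieZl lieZr scalerA lieC scalerN => /oppr_inj /eqP.
  rewrite -{2}[lie e f]scale1r -subr_eq0 -scalerBl scaler_eq0 (negPf h0) orbF.
  by rewrite subr_eq0 => /eqP.
have c0 : c != 0.
  by apply/eqP => c0; move/eqP: cd; rewrite c0 mul0r eq_sym oner_eq0.
(* Chosen so that [t^2 c = 1]: scaling [e] by [t] and [f] by [t c] preserves their bracket. *)
pose t := (sqrtC c)^-1.
have ttc : t * (t * c) = 1.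
  by rewrite mulrA -invfM -expr2 sqrtCK mulVf.
have yE : - tau (t *: e) = (t * c) *: f.
  by rewrite tauZ te scalerN opprK scalerA.
have hE : lie (t *: e) ((t * c) *: f) = lie e f.
  by rewrite lieZl lieZr scalerA ttc scale1r.
exists (t *: e); rewrite yE hE; split.
- exact: subspaceZ.
- exact: subspaceZ.
- by split; rewrite // lieZr ?he ?hf ?scalerN !scalerA mulrC.
- by rewrite !(tauZ, tauN, te, tf) !scalerN opprK !scalerA -mulrA cd mulr1.
Qed.

End LieTorus.

(** * Consistent choices in opposite degrees *)

Theorem lemma5p1p4 (R : realType) (V : vectType R[i]) (D : root_system V)
    (Lam : zmodType) (L : lieAlgType R[i])
    (S : root_lattice D * Lam -> set L) (tau : L -> L) :
  irreducible D -> reduced D -> free_of_finite_rank Lam ->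
  lie_torus S -> centerless L -> chevalley_involution S tau ->
  exists x : root_lattice D -> Lam -> L, chevalley_system S tau x.

Proof.
move=> _ Dred _ torusS _ tauP.
pose good p x := [/\ S p x, S (- p) (- tau x),
  sl2_triple x (lie x (- tau x)) (- tau x) & tau (tau x) = x].
have /boolp.choice[g gP] : forall p, exists x,
    torus_support S p -> p.1 != 0 -> good p x.
  move=> [a l].
  have [[Da Sal]|NS] := pselect (torus_support S (a, l)); last by exists 0.
  have [a0|a0] := eqVneq a 0; first by exists 0 => _ /eqP.
  by have [x] := chevalley_pair Dred torusS tauP Da a0 Sal; exists x.
(* A canonical representative of [{p, - p}]: [choose] returns the same element for extensionally
   equal predicates, so [r] is invariant under negation. *)
pose r (p : root_lattice D * Lam) := choose (pred2 p (- p)) p.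
have rN p : r (- p) = r p.
  rewrite /r (eq_choose (_ : _ =1 pred2 p (- p))).
    by apply: choose_id; rewrite /= !eqxx ?orbT.
  by move=> q /=; rewrite opprK orbC.
have rP p : r p = p \/ r p = - p.
  have : pred2 p (- p) (r p) by apply: chooseP; rewrite /= eqxx.
  by case/orP => /eqP; [left | right].
pose x p := if r p == p then g p else - tau (g (- p)).
exists (fun a l => x (a, l)) => a l Sal a0.
rewrite -[(- a, - l)]/(- (a, l)); set p := (a, l).
have pN : p != - p.
  by apply: contra (root_lattice_neq_opp a0) => /eqP/(congr1 fst) /= <-.
have [rp|rp] := rP p.
  have [Sg _ sl tt] := gP p Sal a0.
  have -> : x p = g p by rewrite /x rp eqxx.
  have -> : x (- p) = - tau (g p) by rewrite /x rN rp (negPf pN) opprK.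
  by split=> //; rewrite opprK.
have Na0 : (- p).1 != 0 by rewrite /= oppr_eq0.
(* The support is symmetric: the partner [- tau y] lies in degree [- p] and is nonzero, as its
   bracket with [y] is nonzero. *)
have SNal : torus_support S (- p).
  have [Da SN0] := Sal; split; first by rewrite raddfN /= root_opp.
  have [y [Sy SNy sl _]] := chevalley_pair Dred torusS tauP Da a0 SN0.
  move=> S0; move: SNy; rewrite -[(- a, - l)]/(- p) S0 => y0.
  by move: (sl2_neq0 sl); rewrite y0 lie0r eqxx.
have [Sg SNg sl tt] := gP (- p) SNal Na0; rewrite opprK in SNg.
have -> : x p = - tau (g (- p)) by rewrite /x rp eq_sym (negPf pN).
have -> : x (- p) = g (- p) by rewrite /x rN rp eqxx.
(* Exchanging the outer members of the triple at [- p] negates the middle one and gives the triple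
   at [p]. *)
case: sl => sl0 _ slx sly; split=> //; last by rewrite (tauN tauP) tt.
split=> //.
- by rewrite lieC oppr_eq0.
- by rewrite (lieC (- _)) lieNl sly opprK.
- by rewrite (lieC (- _)) lieNl slx.
Qed.
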